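(* For $n=4$ there exist a vertex set $V=\{1,2,3,4\}$, edge sets $E,E'$ on $V$, weights $w_{j,k}\ge0$ for $(j,k)\in E$, $w'_{j,k}\in\mathbb{R}$ for $(j,k)\in E'$, and $\mu_j\in\mathbb{R}$ for $j\in V$ such that the Hamiltonian $$H=\sum_{(j,k)\in E}w_{j,k}\Big(\tfrac14\mathbb{1}-n_jn_k\Big)+\sum_{j\in V}\mu_j\Big(n_j-\tfrac12\mathbb{1}\Big)+\sum_{(j,k)\in E'}w'_{j,k}\big(-a_j^\dagger a_k-a_k^\dagger a_j\big)$$ satisfies, for every fermionic Gaussian state $\rho_{\rm Gauss}$ on the four modes, $$\frac{\mathrm{Tr}(\rho_{\rm Gauss}H)}{\lambda_{\max}(H)}\ \le\ 0.99904,$$ where $\lambda_{\max}(H)$ is the largest eigenvalue of $H$.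
   Context: Fermionic modes: $a_1,\dots,a_n\in\mathbb{C}^{2^n\times 2^n}$ are annihilation operators satisfying $a_ja_k^\dagger+a_k^\dagger a_j=\delta_{jk}\mathbb{1}$ and $a_ja_k+a_ka_j=0$, with a vacuum vector $|\mathrm{vac}\rangle$ such that $a_j|\mathrm{vac}\rangle=0$ for all $j$; $n_j=a_j^\dagger a_j$. Majorana operators: $c_{2k-1}=a_k+a_k^\dagger$, $c_{2k}=i(a_k-a_k^\dagger)$, $k=1,\dots,n$. Edges are unordered pairs of distinct vertices. Fermionic Gaussian state: a density matrix of the form $\rho=\frac{1}{2^n}\prod_{j=1}^n(\mathbb{1}+i\lambda_j\tilde c_{2j-1}\tilde c_{2j})$ with $\lambda_j\in[-1,1]$ and $\tilde c_j=\sum_kR_{j,k}c_k$ for some $R\in SO(2n)$. *)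

(* Defs.v *)
From HB Require Import structures.
From mathcomp Require Import all_boot all_order all_algebra zify.
From mathcomp Require Import reals complex.

Set Implicit Arguments.
Unset Strict Implicit.
Unset Printing Implicit Defensive.

Import Order.TTheory GRing.Theory Num.Theory.

Local Open Scope ring_scope.
Local Open Scope complex_scope.

Definition adjoint (R : realType) (m n : nat) (A : 'M[R[i]]_(m, n)) :
  'M[R[i]]_(n, m) := map_mx Num.conj A^T.

Section FermionicModes.

Variables (R : realType) (n : nat).

Local Notation op := 'M[R[i]]_(2 ^ n).

Definition annihilation_operators (a : 'I_n -> op) : Prop :=
  (forall j k : 'I_n,
     a j *m adjoint (a k) + adjoint (a k) *m a j = (j == k)%:R%:M) /\
  (forall j k : 'I_n, a j *m a k + a k *m a j = 0).

Definition vacuum (a : 'I_n -> op) (vac : 'cV[R[i]]_(2 ^ n)) : Prop :=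
  vac != 0 /\ forall j : 'I_n, a j *m vac = 0.

Definition number_op (a : 'I_n -> op) (j : 'I_n) : op := adjoint (a j) *m a j.

Fact mode_subproof (m : 'I_(2 * n)) : (m./2 < n)%N.
Proof. by have := ltn_ord m; lia. Qed.

Fact fst_idx_subproof (k : 'I_n) : (2 * k < 2 * n)%N.
Proof. by have := ltn_ord k; lia. Qed.

Fact snd_idx_subproof (k : 'I_n) : ((2 * k).+1 < 2 * n)%N.
Proof. by have := ltn_ord k; lia. Qed.

(* Majorana indices are 0-based: c_{2k-1} and c_{2k}, for k = 1, ..., n, are at
   the positions 2k' and 2k'+1, where k' = k - 1. *)
Definition mode (m : 'I_(2 * n)) : 'I_n := Ordinal (mode_subproof m).
Definition fst_idx (k : 'I_n) : 'I_(2 * n) := Ordinal (fst_idx_subproof k).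
Definition snd_idx (k : 'I_n) : 'I_(2 * n) := Ordinal (snd_idx_subproof k).

Definition majorana (a : 'I_n -> op) (m : 'I_(2 * n)) : op :=
  if odd m then 'i *: (a (mode m) - adjoint (a (mode m)))
  else a (mode m) + adjoint (a (mode m)).

Definition special_orthogonal (m : nat) (Q : 'M[R]_m) : Prop :=
  Q *m Q^T = 1%:M /\ \det Q = 1.

Definition rotated_majorana (a : 'I_n -> op) (Q : 'M[R]_(2 * n))
    (m : 'I_(2 * n)) : op :=
  \sum_(k < 2 * n) (Q m k)%:C *: majorana a k.

(* On R[i], [x <= y] means that y - x is a nonnegative real. *)
Definition density_matrix (d : nat) (rho : 'M[R[i]]_d) : Prop :=
  [/\ adjoint rho = rho,
      forall v : 'cV[R[i]]_d, 0 <= (adjoint v *m rho *m v) 0 0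
    & \tr rho = 1].

Definition gaussian_state (a : 'I_n -> op) (rho : op) : Prop :=
  density_matrix rho /\
  exists (lam : 'I_n -> R) (Q : 'M[R]_(2 * n)),
    [/\ forall j : 'I_n, -1 <= lam j <= 1,
        special_orthogonal Q
      & rho = ((2 ^+ n)^-1 : R[i]) *:
          \prod_(j < n) (1%:M + ('i * (lam j)%:C) *:
             (rotated_majorana a Q (fst_idx j) *m
              rotated_majorana a Q (snd_idx j)))].

(* An unordered pair {j, k} of distinct vertices is represented by the ordered
   pair (j, k) with j < k. *)
Definition edge_set (E : {set 'I_n * 'I_n}) : Prop :=
  forall e : 'I_n * 'I_n, e \in E -> (e.1 < e.2)%N.

Definition hamiltonian (a : 'I_n -> op) (E E' : {set 'I_n * 'I_n})
    (w w' : 'I_n * 'I_n -> R) (mu : 'I_n -> R) : op :=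
  \sum_(e in E)
     (w e)%:C *: ((4^-1)%:M - number_op a e.1 *m number_op a e.2)
  + \sum_(j < n) (mu j)%:C *: (number_op a j - (2^-1)%:M)
  + \sum_(e in E')
     (w' e)%:C *: (- (adjoint (a e.1) *m a e.2) - adjoint (a e.2) *m a e.1).

End FermionicModes.

Definition largest_eigenvalue (R : realType) (d : nat) (H : 'M[R[i]]_d)
    (lam : R) : Prop :=
  eigenvalue H lam%:C /\ forall z : R[i], eigenvalue H z -> z <= lam%:C.

(* Main.v *)
Require Import Defs.
From mathcomp Require Import all_boot all_order all_algebra ring lra zify.
From mathcomp Require Import reals complex.

(* The instance is the half-filled repulsive Hubbard dimer: modes 0, 1 are the
   two sites for one spin, modes 2, 3 for the other, with U = 6, t = 2 and
   mu = 3. In Majorana operators it reads H = 3/2 (A + B) + P1 + P2 + P3 + P4,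
   where the quartic words A, B are commuting involutions that anticommute with
   the pairwise commuting involutions P1, ..., P4. Hence H^2 <= 9 + 16, and
   the largest eigenvalue 5 is found by applying 5 + H to the common
   eigenspace P1 = ... = P4 = 1.

   A Gaussian rho satisfies the linear relation
   [c_a, rho] = i \sum_b M_ab {c_b, rho} with M real, which implies Wick's
   formula, so - Tr (rho A) is the Pfaffian of a 4 x 4 block of M and is bounded
   by half the sum of the squares of its six entries. The rows of M have norm at
   most 1, so a hopping amplitude p = M_jk and the entries of the quartic
   blocks compete: each p contributes at most 3/4 (1 - p^2) + p <= 13/12.
   Altogether Tr (rho H) <= 13/3, while 13/3 / 5 = 0.866... < 0.99904. *)

Set Implicit Arguments.
Unset Strict Implicit.
Unset Printing Implicit Defensive.

Import Order.TTheory GRing.Theory Num.Theory.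

Local Open Scope ring_scope.
Local Open Scope complex_scope.

(** * Adjoints and positive semidefinite forms *)

Section Adjoint.

Variable R : realType.

Lemma adjointK m n (A : 'M[R[i]]_(m, n)) : adjoint (adjoint A) = A.
Proof. by apply/matrixP => i j; rewrite !mxE conjCK. Qed.

Lemma adjointD m n (A B : 'M[R[i]]_(m, n)) :
  adjoint (A + B) = adjoint A + adjoint B.
Proof. by apply/matrixP => i j; rewrite !mxE rmorphD. Qed.

Lemma adjointN m n (A : 'M[R[i]]_(m, n)) : adjoint (- A) = - adjoint A.
Proof. by apply/matrixP => i j; rewrite !mxE rmorphN. Qed.

Lemma adjointZ m n z (A : 'M[R[i]]_(m, n)) :
  adjoint (z *: A) = Num.conj z *: adjoint A.
Proof. by apply/matrixP => i j; rewrite !mxE rmorphM. Qed.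

Lemma adjointZ_real m n r (A : 'M[R[i]]_(m, n)) :
  adjoint (r%:C *: A) = r%:C *: adjoint A.
Proof. by rewrite adjointZ; congr (_ *: _); apply: conjc_real. Qed.

Lemma adjointM m n p (A : 'M[R[i]]_(m, n)) (B : 'M[R[i]]_(n, p)) :
  adjoint (A *m B) = adjoint B *m adjoint A.
Proof. by rewrite /adjoint trmx_mul map_mxM. Qed.

Lemma adjoint1 n : adjoint (1%:M : 'M[R[i]]_n) = 1%:M.
Proof. by rewrite /adjoint trmx1 map_mx1. Qed.

Lemma adjoint_sum m n I (r : seq I) (P : pred I) (F : I -> 'M[R[i]]_(m, n)) :
  adjoint (\sum_(i <- r | P i) F i) = \sum_(i <- r | P i) adjoint (F i).
Proof.
apply: (big_morph (@adjoint R m n) (@adjointD m n)).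
by apply/matrixP => i j; rewrite !mxE rmorph0.
Qed.

Lemma mul_adjoint_ge0 n (v : 'rV[R[i]]_n) : 0 <= (v *m adjoint v) 0 0.
Proof. by rewrite mxE sumr_ge0 // => i _; rewrite !mxE mul_conjC_ge0. Qed.

Lemma mul_adjoint_gt0 n (v : 'rV[R[i]]_n) : v != 0 -> 0 < (v *m adjoint v) 0 0.
Proof.
move=> v0; rewrite lt_neqAle mul_adjoint_ge0 andbT eq_sym.
apply: contra v0; rewrite mxE psumr_eq0 => [|i _]; last first.
  by rewrite !mxE mul_conjC_ge0.
move=> /allP v0; apply/eqP/rowP => i; have /= := v0 i (mem_index_enum _).
by rewrite !mxE mul_conjC_eq0 => /eqP.
Qed.

(** Row vectors are used because [eigenvalue] refers to left eigenvectors [v *m H = z *: v]. *)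
Definition positive_form n (X : 'M[R[i]]_n) : Prop :=
  forall v : 'rV[R[i]]_n, 0 <= (v *m X *m adjoint v) 0 0.

Lemma positive_formD n (X Y : 'M[R[i]]_n) :
  positive_form X -> positive_form Y -> positive_form (X + Y).
Proof. by move=> pX pY v; rewrite mulmxDr mulmxDl mxE addr_ge0. Qed.

Lemma positive_formZ n z (X : 'M[R[i]]_n) :
  0 <= z -> positive_form X -> positive_form (z *: X).
Proof. by move=> z0 pX v; rewrite -scalemxAr -scalemxAl mxE mulr_ge0. Qed.

Lemma positive_form_sqr n (X : 'M[R[i]]_n) :
  adjoint X = X -> positive_form (X *m X).
Proof.
move=> hX v; have := mul_adjoint_ge0 (v *m X).
by rewrite adjointM hX !mulmxA.
Qed.

(** By cyclicity this is the trace of [X *m rho *m X], whose diagonal entries are the values of the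
    form of [rho] at the columns of [X]. *)
Lemma trace_hermitian_square_ge0 n (rho X : 'M[R[i]]_n) :
  density_matrix rho -> adjoint X = X -> 0 <= \tr (rho *m (X *m X)).
Proof.
case=> _ rho_ge0 _ hX; rewrite mulmxA mxtrace_mulC mulmxA sumr_ge0 // => i _.
have := rho_ge0 (col i X).
have -> : adjoint (col i X) = row i X.
  by apply/rowP => j; rewrite -[in RHS]hX !mxE.
suff -> : (row i X *m rho *m col i X) 0 0 = (X *m rho *m X) i i by [].
by rewrite -row_mul !mxE; apply: eq_bigr => k _; rewrite [in LHS]mxE [X in _ * X]mxE.
Qed.

End Adjoint.

(** * Clifford generators, words and their normal forms *)

Section Clifford.

Variables (R : realType) (m d : nat).

Definition clifford (c : 'I_m -> 'M[R[i]]_d) : Prop :=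
  forall j k, c j *m c k + c k *m c j = ((j == k)%:R *+ 2)%:M.

Definition word (c : 'I_m -> 'M[R[i]]_d) (u : seq 'I_m) : 'M[R[i]]_d :=
  foldr (fun j A => c j *m A) 1%:M u.

(* [sort_word u = (b, v)] means c_u = (-1)^b c_v, with v increasing: squares
   cancel and every transposition of distinct letters flips the sign. *)
Fixpoint insert_letter (j : 'I_m) (u : seq 'I_m) : bool * seq 'I_m :=
  if u isn't k :: v then (false, [:: j]) else
  if j == k then (false, v) else
  if (j < k)%N then (false, j :: u) else
  let: (b, w) := insert_letter j v in (~~ b, k :: w).

Definition sort_word (u : seq 'I_m) : bool * seq 'I_m :=
  foldr (fun j p => let: (b, w) := insert_letter j p.2 in (p.1 (+) b, w))
    (false, [::]) u.

Variable c : 'I_m -> 'M[R[i]]_d.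
Hypothesis cc : clifford c.


Lemma clifford_sqr j : c j *m c j = 1%:M.
Proof.
have := cc j j; rewrite eqxx raddfMn /= => e; apply: (scalerI (a := 2%:R)).
  by rewrite pnatr_eq0.
by rewrite !scaler_nat.
Qed.

Lemma clifford_swap j k : j != k -> c j *m c k = - (c k *m c j).
Proof.
move=> /negPf jk; have := cc j k; rewrite jk mul0rn raddf0 => /eqP.
by rewrite addr_eq0 => /eqP.
Qed.

Lemma word_cat u v : word c (u ++ v) = word c u *m word c v.
Proof. by elim: u => [|j u IHu] /=; rewrite ?mul1mx // IHu mulmxA. Qed.

Lemma insert_letterE j u :
  c j *m word c u =
  (-1) ^+ (insert_letter j u).1 *: word c (insert_letter j u).2.
Proof.
elim: u => [|k u IHu] /=; first by rewrite expr0 scale1r.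
case: eqP => [->|/eqP jk]; first by rewrite mulmxA clifford_sqr mul1mx scale1r.
case: ifP => _; first by rewrite scale1r.
case: (insert_letter j u) IHu => b w /= IHu.
rewrite mulmxA clifford_swap // mulNmx -mulmxA IHu -scalemxAr -scaleNr.
by rewrite signrN.
Qed.

Lemma sort_wordE u :
  word c u = (-1) ^+ (sort_word u).1 *: word c (sort_word u).2.
Proof.
elim: u => [|j u IHu] /=; first by rewrite scale1r.
rewrite IHu -scalemxAr insert_letterE scalerA -signr_addb.
by case: (insert_letter _ _).
Qed.

Lemma word_sorted_eq u v : (sort_word u).2 = (sort_word v).2 ->
  word c u = (-1) ^+ ((sort_word u).1 (+) (sort_word v).1) *: word c v.
Proof.
move=> uv; rewrite sort_wordE uv [word c v]sort_wordE scalerA -signr_addb.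
by rewrite -addbA addbb addbF.
Qed.

(** Phrased through boolean computations, so that for concrete words both premises hold by
    reduction. *)
Lemma word_eq_sign b u v :
  (sort_word u).2 == (sort_word v).2 -> (sort_word u).1 (+) (sort_word v).1 = b ->
  word c u = (-1) ^+ b *: word c v.
Proof. by move=> /eqP uv <-; apply: word_sorted_eq. Qed.

Lemma adjoint_word u : (forall j, adjoint (c j) = c j) ->
  adjoint (word c u) = word c (rev u).
Proof.
move=> hc; elim: u => [|j u IHu]; first by rewrite /= adjoint1.
by rewrite rev_cons -cats1 word_cat /= adjointM hc mulmx1 IHu.
Qed.

Definition clifford_vector (f : 'I_m -> R) : 'M[R[i]]_d :=
  \sum_k (f k)%:C *: c k.

Lemma clifford_vector_anticommutator f g :
  clifford_vector f *m clifford_vector g + clifford_vector g *m clifford_vector f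
  = ((\sum_k f k * g k) *+ 2)%:C%:M.
Proof.
transitivity (\sum_p \sum_q ((f p)%:C * (g q)%:C) *:
    (((p == q)%:R *+ 2)%:M : 'M[R[i]]_d)).
  rewrite mulmx_suml [X in _ + X]mulmx_sumr -big_split /=.
  apply: eq_bigr => p _; rewrite mulmx_sumr mulmx_suml -big_split /=.
  apply: eq_bigr => q _; rewrite -cc scalerDr -!scalemxAl -!scalemxAr !scalerA.
  by rewrite [X in _ + X *: _ = _]mulrC.
symmetry; rewrite -sumrMnl raddf_sum raddf_sum; apply: eq_bigr => p _ /=.
rewrite (bigD1 p) //= eqxx big1 ?addr0 => [|q /negPf].
  by rewrite scale_scalar_mx rmorphMn rmorphM /= -mulr_natr.
by rewrite eq_sym => ->; rewrite mul0rn raddf0 scaler0.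
Qed.

End Clifford.

(** * Wick's formula for two and four generators *)

Section Wick.

Variables (R : realType) (m d : nat) (c : 'I_m -> 'M[R[i]]_d).
Hypothesis cc : clifford c.

Variables (rho : 'M[R[i]]_d) (M : 'I_m -> 'I_m -> R).
Hypothesis rhoM : forall j, c j *m rho - rho *m c j =
  'i *: \sum_k (M j k)%:C *: (c k *m rho + rho *m c k).

(** Cyclicity moves the commutator from [X] onto [rho], where [rhoM] applies; cyclicity again turns
    the anticommutators with [rho] into anticommutators with [X]. *)
Lemma trace_commutator j X :
  \tr (rho *m (X *m c j - c j *m X)) =
  'i * \sum_k (M j k)%:C * \tr (rho *m (X *m c k + c k *m X)).
Proof.
rewrite mulmxBr !mulmxA raddfB /= [\tr (rho *m X *m _)]mxtrace_mulC !mulmxA.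
rewrite -raddfB /= -mulmxBl rhoM -scalemxAl mxtraceZ mulmx_suml raddf_sum /=.
congr (_ * _); apply: eq_bigr => k _; rewrite -scalemxAl mxtraceZ mulmxDl.
by rewrite mulmxDr !raddfD /= !mulmxA [\tr (rho *m X *m _)]mxtrace_mulC !mulmxA.
Qed.

(** Moving [c k] leftwards through the three letters leaves one delta term per crossing, with
    alternating signs; three crossings turn the remaining word into its negative, which cancels. *)
Lemma clifford_anticommutator3 x y z k :
  c x *m c y *m c z *m c k + c k *m (c x *m c y *m c z) =
  ((k == z)%:R *+ 2) *: (c x *m c y) - ((k == y)%:R *+ 2) *: (c x *m c z)
  + ((k == x)%:R *+ 2) *: (c y *m c z).
Proof.
have sw p : c p *m c k = ((k == p)%:R *+ 2)%:M - c k *m c p.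
  by rewrite eq_sym -cc addrK.
rewrite -mulmxA sw mulmxBr mul_mx_scalar !mulmxA.
rewrite -[_ *m c y *m c k]mulmxA sw mulmxBr mul_mx_scalar mulmxBl -scalemxAl.
rewrite !mulmxA sw !mulmxBl !mul_scalar_mx -!scalemxAl !opprB addrA.
by rewrite addrAC addrA subrK addrAC.
Qed.

Hypothesis rho1 : \tr rho = 1.

Lemma sum_mul_delta (f : 'I_m -> R[i]) x :
  \sum_k f k * (k == x)%:R = f x.
Proof.
rewrite (bigD1 x) //= eqxx mulr1 big1 ?addr0 // => k /negPf ->.
by rewrite mulr0.
Qed.

(** In [trace_commutator] with [X = c y], the commutator is [-2] times [c x *m c y], while the
    anticommutators are scalars, nonzero only for [k = y]. *)
Lemma wick2 x y : x != y -> \tr (rho *m (c x *m c y)) = - 'i * (M x y)%:C.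
Proof.
move=> xy; have := trace_commutator x (c y).
rewrite (clifford_swap cc (j := y)) 1?eq_sym // -opprD.
rewrite mulmxN mulmxDr raddfN raddfD /= -mulr2n.
rewrite (eq_bigr (fun k => ((M x k)%:C * (k == y)%:R) *+ 2)); last first.
  move=> k _; rewrite addrC cc mul_mx_scalar mxtraceZ rho1 mulr1.
  by rewrite -mulrnAr.
rewrite sumrMnl sum_mul_delta => e.
by apply: (pmulrnI (n := 2)) => //; rewrite mulNr mulNrn -mulrnAr -e opprK.
Qed.

(** The same argument with [X] a product of three letters: [c x] anticommutes with it, and each
    anticommutator on the right reduces to words of length two, evaluated by [wick2]. *)
Lemma wick4 x y z t : uniq [:: x; y; z; t] ->
  \tr (rho *m (c x *m (c y *m c z *m c t))) =
  - (M x y * M z t - M x z * M y t + M x t * M y z)%:C.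
Proof.
rewrite /= !inE !negb_or => /and4P[/and3P[xy xz xt] /andP[yz yt] zt _].
have trN (X : 'M[R[i]]_d) : \tr (- X) = - \tr X by rewrite raddfN.
have := trace_commutator x (c y *m c z *m c t).
have -> : c y *m c z *m c t *m c x = - (c x *m (c y *m c z *m c t)).
  apply/eqP; rewrite -addr_eq0 clifford_anticommutator3.
  by rewrite (negPf xy) (negPf xz) (negPf xt) mul0rn !scale0r subr0 addr0.
rewrite -opprD mulmxN mulmxDr raddfN raddfD /= -mulr2n.
rewrite (eq_bigr (fun k =>
  ((M x k)%:C * (- 'i * (M y z)%:C)) * (k == t)%:R *+ 2
  - ((M x k)%:C * (- 'i * (M y t)%:C)) * (k == z)%:R *+ 2
  + ((M x k)%:C * (- 'i * (M z t)%:C)) * (k == y)%:R *+ 2)); last first.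
  move=> k _; rewrite clifford_anticommutator3 !(mulmxDr, mulmxN) -!scalemxAr.
  rewrite !(mxtraceD, trN) !mxtraceZ !wick2 //.
  by rewrite !mulrDr !mulrN !mulrnAl !mulrnAr; ring.
rewrite !big_split /= sumrN !sumrMnl !sum_mul_delta => e.
apply: (pmulrnI (n := 2)) => //; apply: oppr_inj; rewrite e.
rewrite !(rmorphD, rmorphN, rmorphM) /=.
have := sqrCi R[i]; rewrite expr2 => ii.
ring: ii.
Qed.

End Wick.

(** * Antisymmetry and row norms of the covariance matrix *)

Section Covariance.

Variables (R : realType) (m d : nat) (c : 'I_m -> 'M[R[i]]_d).
Hypothesis cc : clifford c.

Variables (rho : 'M[R[i]]_d) (M : 'I_m -> 'I_m -> R).
Hypothesis rhoM : forall j, c j *m rho - rho *m c j =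
  'i *: \sum_k (M j k)%:C *: (c k *m rho + rho *m c k).
Hypothesis hrho : density_matrix rho.
Hypothesis hc : forall j, adjoint (c j) = c j.

Let rho1 : \tr rho = 1. Proof. by case: hrho. Qed.

Lemma covariance_antisym j k : j != k -> M k j = - M j k.
Proof.
move=> jk; have kj : k != j by rewrite eq_sym.
have := wick2 cc rhoM rho1 kj; rewrite (clifford_swap cc kj) mulmxN raddfN /=.
rewrite (wick2 cc rhoM rho1 jk) -mulrN => /(mulfI _) e.
apply: (fmorph_inj (real_complex R)); rewrite rmorphN e // oppr_eq0.
exact: neq0Ci.
Qed.

(* i c_j times a real unit combination of the c_k, k <> j, squares to 1, hence
   has expectation at most 1; take the combination proportional to row j. *)
Lemma covariance_row_le1 j (s : seq 'I_m) :
  uniq s -> j \notin s -> \sum_(k <- s) M j k ^+ 2 <= 1.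
Proof.
move=> us js; rewrite big_uniq //=; set q := \sum_(k in s) _.
have q0 : 0 <= q by apply: sumr_ge0 => k _; rewrite sqr_ge0.
pose f k : R := (k == j)%:R; pose g k : R := if k \in s then M j k else 0.
have vf : clifford_vector c f = c j.
  rewrite /clifford_vector (bigD1 j) //= /f eqxx scale1r big1 ?addr0 // => k /negPf ->.
  by rewrite scale0r.
have /eqP := clifford_vector_anticommutator cc f g.
have := clifford_vector_anticommutator cc g g; rewrite vf.
set v := clifford_vector c g; have -> : \sum_k g k * g k = q.
  rewrite /q [RHS]big_mkcond /=; apply: eq_bigr => k _; rewrite /g expr2.
  by case: (k \in s); rewrite ?mul0r.
rewrite !raddfMn /= -mulr2n => vv; rewrite big1 => [|k _]; last first.
  rewrite /f /g; have [->|_] := eqVneq k j; last by rewrite mul0r.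
  by rewrite (negPf js) mulr0.
rewrite !raddf0 mul0rn addr_eq0 => /eqP cv.
have {}vv : v *m v = q%:C%:M.
  by apply: (scalerI (a := 2%:R)); rewrite ?pnatr_eq0 // !scaler_nat.
have hv : adjoint v = v.
  rewrite /v /clifford_vector adjoint_sum; apply: eq_bigr => k _.
  by rewrite adjointZ_real hc.
pose X := 'i *: (c j *m v).
have hX : adjoint X = X.
  by rewrite /X adjointZ conjCi adjointM hc hv scaleNr -scalerN cv.
have XX : X *m X = q%:C%:M.
  rewrite /X -scalemxAl -scalemxAr scalerA -expr2 sqrCi {1}cv mulNmx scaleN1r opprK.
  by rewrite -mulmxA (mulmxA (c j) (c j)) (clifford_sqr cc) mul1mx vv.
have trX : \tr (rho *m X) = q%:C.
  rewrite /X -scalemxAr mxtraceZ /v /clifford_vector !mulmx_sumr raddf_sum /=.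
  rewrite mulr_sumr /q [in RHS]big_mkcond rmorph_sum /=; apply: eq_bigr => k _.
  rewrite -!scalemxAr mxtraceZ /g; case: ifP => ks; last by rewrite !rmorph0 mul0r mulr0.
  rewrite (wick2 cc rhoM rho1); last by apply: contraNneq js => ->.
  by have := sqrCi R[i]; rewrite expr2 => ii; rewrite rmorphXn /=; ring: ii.
move: X hX XX trX => X hX XX trX.
have hq : adjoint (X - q%:C%:M) = X - q%:C%:M.
  by rewrite adjointD adjointN hX -scalemx1 adjointZ_real adjoint1.
(* The combination is left unnormalised, which also covers [q = 0]: since [X] has square [q] and
   expectation [q], the expectation of the square of [X - q] is [q - q ^+ 2], and its nonnegativity
   forces [q <= 1]. *)
have := trace_hermitian_square_ge0 hrho hq.
have -> : \tr (rho *m ((X - q%:C%:M) *m (X - q%:C%:M))) = (q - q ^+ 2)%:C.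
  rewrite mulmxBl !mulmxBr XX !mul_mx_scalar !mul_scalar_mx scale_scalar_mx.
  rewrite -!scalemxAr mul_mx_scalar !raddfB /= !mxtraceZ trX rho1.
  by rewrite rmorphXn /=; ring.
rewrite (lecR 0) => q2; have [//|q1] := lerP q 1.
by have := mulr_gt0 (lt_trans ltr01 q1) (etrans (subr_gt0 _ _) q1); lra.
Qed.

End Covariance.

(** * The linear commutator relation and its stability under products *)

Section Twist.

Variables (R : realType) (d : nat).

Definition twists (z : R[i]) (e f rho : 'M[R[i]]_d) : Prop :=
  e *m rho - rho *m e = z *: (f *m rho + rho *m f).

Lemma twists_mull z e f A rho : A *m e = e *m A -> A *m f = f *m A ->
  twists z e f rho -> twists z e f (A *m rho).
Proof.
move=> Ae Af; rewrite /twists !mulmxA -Ae -Af -!mulmxA -mulmxBr => ->.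
by rewrite -scalemxAr mulmxDr.
Qed.

Lemma twists_mulr z e f A rho : A *m e = e *m A -> A *m f = f *m A ->
  twists z e f rho -> twists z e f (rho *m A).
Proof.
move=> Ae Af; rewrite /twists -!mulmxA Ae Af !mulmxA -mulmxBl => ->.
by rewrite -scalemxAl mulmxDl.
Qed.

Lemma twistsZ z e f k rho : twists z e f rho -> twists z e f (k *: rho).
Proof.
rewrite /twists -!scalemxAr -!scalemxAl -scalerBr => ->.
by rewrite -scalerDr !scalerA mulrC.
Qed.

Lemma commute_prod (I : eqType) (r : seq I) (F : I -> 'M[R[i]]_d) e :
  {in r, forall i, F i *m e = e *m F i} ->
  (\prod_(i <- r) F i) *m e = e *m \prod_(i <- r) F i.
Proof.
elim: r => [|i r IHr] Fe; first by rewrite big_nil mul1mx mulmx1.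
rewrite big_cons -mulmxE -mulmxA IHr => [|k kr]; last first.
  by rewrite Fe // inE kr orbT.
by rewrite !mulmxA Fe // inE eqxx.
Qed.

(** Only factor [j] interacts with [e] and [f]; the factors to its left and right commute with both
    and are absorbed by [twists_mull] and [twists_mulr]. *)
Lemma twists_prod (I : eqType) (r : seq I) (F : I -> 'M[R[i]]_d) j z e f :
  uniq r -> j \in r ->
  (forall i, i != j -> F i *m e = e *m F i /\ F i *m f = f *m F i) ->
  twists z e f (F j) -> twists z e f (\prod_(i <- r) F i).
Proof.
elim: r => // i r IHr /= /andP[ir ur]; rewrite inE big_cons -mulmxE eq_sym.
 have [ij _ Fef tj|ij] := eqVneq i j.
  subst i.
  have nj k : k \in r -> k != j by move=> kr; apply: contraNneq ir => <-.
  by apply: twists_mulr => //; apply: commute_prod => k /nj /Fef [].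
move=> /= jr Fef tj.
have [Fe Ff] := Fef i ij.
by apply: twists_mull => //; apply: IHr.
Qed.

(** The commutator of [e] with the factor is [2 z f]. In the anticommutator of [f] with it the terms
    in [z] cancel, leaving [2 f]. Exchanging [e] and [f] reverses the sign of [z]. *)
Lemma twists_factor z e f : e *m e = 1%:M -> f *m f = 1%:M ->
    e *m f = - (f *m e) ->
  twists z e f (1%:M + z *: (e *m f)) /\ twists (- z) f e (1%:M + z *: (e *m f)).
Proof.
move=> ee ff ef; rewrite /twists !mulmxDr !mulmxDl !mulmx1 !mul1mx.
rewrite -!scalemxAr -!scalemxAl !mulmxA ee -[e *m f *m f]mulmxA ff.
have -> : e *m f *m e = - f by rewrite -mulmxA -[f *m e]opprK -ef mulmxN mulmxA ee mul1mx.
have -> : f *m e *m f = - e by rewrite -mulmxA ef mulmxN mulmxA ff mul1mx.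
by split; apply/matrixP => i j; rewrite !(mulmx1, mul1mx) !mxE; ring.
Qed.

End Twist.

(** * Majorana operators and the commutator relation of Gaussian states *)

Section Gaussian.

Variables (R : realType) (n : nat) (a : 'I_n -> 'M[R[i]]_(2 ^ n)).
Hypothesis ha : annihilation_operators a.

(** Both kinds of Majorana operator have this shape, so a single anticommutator formula covers all
    parity cases. *)
Definition ladder (u v : R[i]) (j : 'I_n) : 'M[R[i]]_(2 ^ n) :=
  u *: a j + v *: adjoint (a j).

Lemma ladder_anticommutator u v u' v' j k :
  ladder u v j *m ladder u' v' k + ladder u' v' k *m ladder u v j =
  ((u * v' + v * u') * (j == k)%:R)%:M.
Proof.
case: ha => aad aa.
have adad : adjoint (a j) *m adjoint (a k) + adjoint (a k) *m adjoint (a j) = 0.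
  by rewrite -!adjointM -adjointD addrC aa; apply/matrixP => p q; rewrite !mxE rmorph0.
have adkj := aad k j.
rewrite /ladder !(mulmxDl, mulmxDr) -!scalemxAl -!scalemxAr !scalerA.
transitivity ((u * u') *: (a j *m a k + a k *m a j)
  + (u * v') *: (a j *m adjoint (a k) + adjoint (a k) *m a j)
  + (v * u') *: (a k *m adjoint (a j) + adjoint (a j) *m a k)
  + (v * v') *: (adjoint (a j) *m adjoint (a k) + adjoint (a k) *m adjoint (a j))).
  rewrite !scalerDr.
  move: (a j *m a k) (a k *m a j) (a j *m adjoint (a k)) (adjoint (a k) *m a j)
    (a k *m adjoint (a j)) (adjoint (a j) *m a k) (adjoint (a j) *m adjoint (a k))
    (adjoint (a k) *m adjoint (a j)) => A1 A2 A3 A4 A5 A6 A7 A8.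
  by apply/matrixP => p q; rewrite !mxE; ring.
rewrite aa aad adkj adad !scaler0 add0r addr0 !scale_scalar_mx.
by rewrite -raddfD /= (eq_sym k) mulrDl.
Qed.

Lemma majoranaE m : majorana a m =
  if odd m then ladder 'i%R (- 'i)%R (mode m) else ladder 1 1 (mode m).
Proof.
rewrite /majorana /ladder; case: ifP => _; last by rewrite !scale1r.
by rewrite scalerBr scaleNr.
Qed.

Lemma mode_eq (j k : 'I_(2 * n)) :
  (j == k) = (odd j == odd k) && (mode j == mode k).
Proof. by rewrite -!val_eqE /=; lia. Qed.

Lemma majorana_clifford : clifford (majorana a).
Proof.
have := sqrCi R[i]; rewrite expr2 => ii; move=> j k; rewrite !majoranaE mode_eq.
case: (odd j); case: (odd k); rewrite ladder_anticommutator;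
  case: (mode j == mode k) => /=; congr (_%:M); ring: ii.
Qed.

Lemma adjoint_majorana m : adjoint (majorana a m) = majorana a m.
Proof.
rewrite /majorana; case: ifP => _.
  by rewrite adjointZ conjCi adjointD adjointN adjointK scaleNr -scalerN opprB.
by rewrite adjointD adjointK addrC.
Qed.


Variable Q : 'M[R]_(2 * n).
Hypothesis QQ : Q *m Q^T = 1%:M.

Local Notation rot := (rotated_majorana a Q).

Lemma rotated_majorana_clifford : clifford rot.
Proof.
move=> j k.
rewrite (clifford_vector_anticommutator majorana_clifford (Q j) (Q k)).
have := congr1 (fun A => fun_of_matrix A j k) QQ; rewrite !mxE.
by under eq_bigr do rewrite mxE; move=> ->; rewrite rmorphMn /= rmorph_nat.
Qed.

Lemma majorana_rotated j : majorana a j = \sum_m (Q m j)%:C *: rot m.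
Proof.
under eq_bigr do rewrite scaler_sumr; rewrite exchange_big /=.
have QkQj k : \sum_m Q m j * Q m k = (j == k)%:R.
  have := congr1 (fun A => fun_of_matrix A j k) (mulmx1C QQ).
  by rewrite !mxE; under eq_bigr do rewrite mxE.
under eq_bigr do [under eq_bigr do rewrite scalerA -rmorphM; rewrite -scaler_suml -rmorph_sum QkQj].
rewrite (bigD1 j) //= eqxx scale1r big1 ?addr0 // => k /negPf.
by rewrite eq_sym => ->; rewrite scale0r.
Qed.

Variable lam : 'I_n -> R.

Definition partner (m : 'I_(2 * n)) : 'I_(2 * n) :=
  if odd m then fst_idx (mode m) else snd_idx (mode m).

(** The sign records the two orientations of a pair in [twists_factor]. *)
Definition coupling (m : 'I_(2 * n)) : R :=
  if odd m then - lam (mode m) else lam (mode m).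

Local Notation pair_factor j :=
  (1%:M + ('i * (lam j)%:C) *: (rot (fst_idx j) *m rot (snd_idx j))).

Lemma modeK (m : 'I_(2 * n)) :
  m = if odd m then snd_idx (mode m) else fst_idx (mode m).
Proof. by apply/val_inj; case: ifP => om /=; lia. Qed.

(** A pair factor of another mode contains two letters, both anticommuting with [rot m] and with its
    partner; the two signs cancel, so that factor commutes and [twists_prod] applies. *)
Lemma twists_gaussian m :
  twists ('i * (coupling m)%:C) (rot m) (rot (partner m))
    (\prod_(j < n) pair_factor j).
Proof.
have rc := rotated_majorana_clifford.
have fs (j : 'I_n) : fst_idx j != snd_idx j by rewrite -val_eqE /=; lia.
have comm i (k : 'I_(2 * n)) : i != mode k ->
    pair_factor i *m rot k = rot k *m pair_factor i.
  move=> ik; rewrite mulmxDl mulmxDr mul1mx mulmx1 -scalemxAl -scalemxAr.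
  congr (_ + _ *: _).
  rewrite -mulmxA (clifford_swap rc (j := snd_idx i) (k := k)); last first.
    by move: ik; rewrite -!val_eqE /=; lia.
  rewrite mulmxN mulmxA (clifford_swap rc (j := fst_idx i) (k := k)); last first.
    by move: ik; rewrite -!val_eqE /=; lia.
  by rewrite mulNmx opprK mulmxA.
have [t1 t2] := twists_factor ('i * (lam (mode m))%:C)
  (clifford_sqr rc _) (clifford_sqr rc _) (clifford_swap rc (fs (mode m))).
apply: (@twists_prod _ _ _ _ _ (mode m)).
- by rewrite index_enum_uniq.
- by rewrite mem_index_enum.
- move=> i im; split; apply: comm => //.
  suff -> : mode (partner m) = mode m by [].
  by apply/val_inj; rewrite /partner; case: ifP => /= _; lia.
- rewrite (congr1 rot (modeK m)) /partner /coupling; case: ifP => _.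
    by rewrite rmorphN /= mulrN; exact: t2.
  exact: t1.
Qed.

Lemma gaussian_commutator : exists M : 'I_(2 * n) -> 'I_(2 * n) -> R,
  forall k rho, rho = k *: \prod_(j < n) pair_factor j ->
  forall j, majorana a j *m rho - rho *m majorana a j =
    'i *: \sum_k (M j k)%:C *: (majorana a k *m rho + rho *m majorana a k).
Proof.
(* This is the matrix product of [Q^T], C and [Q], where C has entry [coupling m] at
   [(m, partner m)] and zeros elsewhere: the relation is known for the rotated operators and is
   carried back to the original ones. *)
exists (fun j k => \sum_m Q m j * coupling m * Q (partner m) k) => k rho -> j.
have := fun m => twistsZ k (twists_gaussian m).
move: (k *: _) => G tG.
rewrite majorana_rotated mulmx_suml mulmx_sumr -sumrB scaler_sumr.
transitivity (\sum_m ('i * (Q m j * coupling m)%:C) *: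
    (rot (partner m) *m G + G *m rot (partner m))).
  apply: eq_bigr => m _; rewrite -scalemxAl -scalemxAr -scalerBr.
  rewrite tG scalerA rmorphM /=.
  by congr (_ *: _); ring.
under [RHS]eq_bigr do rewrite rmorph_sum scaler_suml scaler_sumr.
rewrite exchange_big /=; apply: eq_bigr => m _.
rewrite /rotated_majorana mulmx_suml mulmx_sumr -big_split scaler_sumr.
apply: eq_bigr => l _ /=; rewrite -scalemxAl -scalemxAr -scalerDr !scalerA.
by congr (_ *: _); rewrite !rmorphM /= !mulrA.
Qed.

End Gaussian.

(** * Largest eigenvalue of the sum of two anticommuting parts *)

Section AnticommutingSplit.

Variables (R : realType) (d : nat).
Variables (A B P1 P2 P3 P4 : 'M[R[i]]_d).

Hypotheses (AA : A *m A = 1%:M) (BB : B *m B = 1%:M) (AB : A *m B = B *m A).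
Hypotheses (P11 : P1 *m P1 = 1%:M) (P22 : P2 *m P2 = 1%:M)
  (P33 : P3 *m P3 = 1%:M) (P44 : P4 *m P4 = 1%:M).
Hypotheses (P12 : P1 *m P2 = P2 *m P1) (P13 : P1 *m P3 = P3 *m P1)
  (P14 : P1 *m P4 = P4 *m P1) (P23 : P2 *m P3 = P3 *m P2)
  (P24 : P2 *m P4 = P4 *m P2) (P34 : P3 *m P4 = P4 *m P3).
Hypotheses (AP1 : A *m P1 = - (P1 *m A)) (AP2 : A *m P2 = - (P2 *m A))
  (AP3 : A *m P3 = - (P3 *m A)) (AP4 : A *m P4 = - (P4 *m A)).
Hypotheses (BP1 : B *m P1 = - (P1 *m B)) (BP2 : B *m P2 = - (P2 *m B))
  (BP3 : B *m P3 = - (P3 *m B)) (BP4 : B *m P4 = - (P4 *m B)).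

Let Y := P1 + P2 + P3 + P4.
Let H := (3 / 2) *: (A + B) + Y.

(** Each squared difference equals 2 minus twice the product of the two involutions, so the six of
    them account for all cross terms of [Y *m Y]. *)
Lemma hopping_sqr : Y *m Y = 16%:M -
  ((P1 - P2) *m (P1 - P2) + (P1 - P3) *m (P1 - P3) + (P1 - P4) *m (P1 - P4)
   + (P2 - P3) *m (P2 - P3) + (P2 - P4) *m (P2 - P4) + (P3 - P4) *m (P3 - P4)).
Proof.
rewrite /Y !(mulmxDl, mulmxDr, mulmxN, mulNmx) ?opprK P11 P22 P33 P44.
rewrite -P12 -P13 -P14 -P23 -P24 -P34.
move: (P1 *m P2) (P1 *m P3) (P1 *m P4) (P2 *m P3) (P2 *m P4) (P3 *m P4).
by move=> *; apply/matrixP => i j; rewrite !mxE; case: (i == j) => /=; ring.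
Qed.

Lemma interaction_hopping_anticommute : (A + B) *m Y = - (Y *m (A + B)).
Proof.
rewrite /Y !(mulmxDl, mulmxDr) AP1 AP2 AP3 AP4 BP1 BP2 BP3 BP4.
move: (P1 *m A) (P2 *m A) (P3 *m A) (P4 *m A).
move: (P1 *m B) (P2 *m B) (P3 *m B) (P4 *m B).
by move=> *; apply/matrixP => i j; rewrite !mxE; ring.
Qed.

Lemma interaction_sqr : (A + B) *m (A + B) = 2%:M + (A *m B) *+ 2.
Proof.
rewrite !(mulmxDl, mulmxDr) AA BB -AB; move: (A *m B) => C.
by apply/matrixP => i j; rewrite !mxE; case: (i == j) => /=; ring.
Qed.

Lemma hamiltonian_sqr :
  H *m H = (9 / 4) *: ((A + B) *m (A + B)) + Y *m Y.
Proof.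
move: interaction_hopping_anticommute; rewrite /H.
move: (A + B) Y => X Z XZ; rewrite mulmxDl !mulmxDr -!scalemxAl -!scalemxAr.
rewrite scalerA XZ scalerN addrA addrNK.
by rewrite mulf_div -!natrM.
Qed.

(** A sum-of-squares certificate. The left side is the square of [5 - H] plus [25 - H *m H]; in the
    latter, 25 splits as 9 + 16, where [A + B] has square 4 minus that of [A - B], and [hopping_sqr]
    treats [Y]. *)
Lemma hamiltonian_sos : 10 *: (5%:M - H) =
  (5%:M - H) *m (5%:M - H) + (9 / 4) *: ((A - B) *m (A - B)) +
  ((P1 - P2) *m (P1 - P2) + (P1 - P3) *m (P1 - P3) + (P1 - P4) *m (P1 - P4)
   + (P2 - P3) *m (P2 - P3) + (P2 - P4) *m (P2 - P4) + (P3 - P4) *m (P3 - P4)).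
Proof.
set S := (X in _ = _ + X).
have -> : (5%:M - H) *m (5%:M - H) = 25%:M - 10 *: H + H *m H.
  move: H => K; rewrite !(mulmxDl, mulmxDr) !(mulmxN, mulNmx) -scalar_mxM.
  rewrite mul_scalar_mx mul_mx_scalar; move: (K *m K) => KK.
  by apply/matrixP => i j; rewrite !mxE opprK; case: (i == j) => /=; ring.
rewrite hamiltonian_sqr hopping_sqr -/S interaction_sqr.
have -> : (A - B) *m (A - B) = 2%:M - (A *m B) *+ 2.
  rewrite !(mulmxDl, mulmxDr, mulmxN, mulNmx) AA BB -AB; move: (A *m B) => C.
  by apply/matrixP => i j; rewrite !mxE; case: (i == j) => /=; ring.
move: S H (A *m B) => S K C.
apply/matrixP => i j; rewrite !mxE.
by case: (i == j) => /=; field.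
Qed.

Hypotheses (hA : adjoint A = A) (hB : adjoint B = B) (hP1 : adjoint P1 = P1)
  (hP2 : adjoint P2 = P2) (hP3 : adjoint P3 = P3) (hP4 : adjoint P4 = P4).

(** Evaluating the certificate [hamiltonian_sos] at a left eigenvector gives [10 * (5 - z)] times a
    positive squared norm. *)
Lemma eigenvalue_le5 z : eigenvalue H z -> z <= 5.
Proof.
case/eigenvalueP => v vH v0; have vv := mul_adjoint_gt0 v0.
have hH : adjoint (5%:M - H) = 5%:M - H.
  have h32 : Num.conj (3 / 2 : R[i]) = 3 / 2 by rewrite rmorphM fmorphV !rmorph_nat.
  have h5 : adjoint (5%:M : 'M[R[i]]_d) = 5%:M.
    by rewrite -scalemx1 adjointZ adjoint1 rmorph_nat.
  by rewrite /H /Y !(adjointD, adjointN, adjointZ) h5 h32 hA hB hP1 hP2 hP3 hP4.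
have hd S T : adjoint S = S -> adjoint T = T -> adjoint (S - T) = S - T :> 'M[R[i]]_d.
  by move=> hS hT; rewrite adjointD adjointN hS hT.
have : 0 <= (v *m (10 *: (5%:M - H)) *m adjoint v) 0 0.
  rewrite hamiltonian_sos; move: v {vH v0 vv}; apply: positive_formD; last first.
    by do 5 (apply: positive_formD; last by apply/positive_form_sqr/hd); apply/positive_form_sqr/hd.
  apply: positive_formD; first exact: positive_form_sqr.
  by apply: positive_formZ; [rewrite divr_ge0 | apply/positive_form_sqr/hd].
rewrite -scalemxAr mulmxBr vH mul_mx_scalar -scalerBl scalerA -scalemxAl mxE.
by rewrite pmulr_lge0 // pmulr_rge0 ?ltr0n // subr_ge0.
Qed.

Hypothesis ABP : A *m B = P1 *m P2 *m P3 *m P4.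

(** Sixteen times the projection onto the common eigenspace where all four involutions equal 1. *)
Let aligned := (1%:M + P1) *m (1%:M + P2) *m (1%:M + P3) *m (1%:M + P4).

Lemma aligned_mul : [/\ aligned *m P1 = aligned, aligned *m P2 = aligned,
  aligned *m P3 = aligned & aligned *m P4 = aligned].
Proof.
have cm (X Z : 'M[R[i]]_d) : X *m Z = Z *m X -> (1%:M + X) *m Z = Z *m (1%:M + X).
  by move=> XZ; rewrite mulmxDl mulmxDr XZ mulmx1 mul1mx.
have ab (X : 'M[R[i]]_d) : X *m X = 1%:M -> (1%:M + X) *m X = 1%:M + X.
  by move=> XX; rewrite mulmxDl XX mul1mx addrC.
have [c21 c31 c41] := And3 (cm _ _ (esym P12)) (cm _ _ (esym P13)) (cm _ _ (esym P14)).
have [c32 c42 c43] := And3 (cm _ _ (esym P23)) (cm _ _ (esym P24)) (cm _ _ (esym P34)).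
have [a1 a2 a3 a4] := And4 (ab _ P11) (ab _ P22) (ab _ P33) (ab _ P44).
rewrite /aligned; move: (1%:M + P1) (1%:M + P2) (1%:M + P3) (1%:M + P4)
  c21 c31 c41 c32 c42 c43 a1 a2 a3 a4.
move=> Q1 Q2 Q3 Q4 c21 c31 c41 c32 c42 c43 a1 a2 a3 a4; split.
- rewrite -(mulmxA _ Q4) c41 mulmxA -(mulmxA _ Q3) c31 mulmxA.
  by rewrite -(mulmxA _ Q2) c21 mulmxA a1.
- by rewrite -(mulmxA _ Q4) c42 mulmxA -(mulmxA _ Q3) c32 mulmxA -(mulmxA _ Q2) a2.
- by rewrite -(mulmxA _ Q4) c43 mulmxA -(mulmxA _ Q3) a3.
- by rewrite -(mulmxA _ Q4) a4.
Qed.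

(** On the range of [aligned], [Y] is 4 and [ABP] makes [A *m B] equal to 1, so [H *m H] is 25 there
    and [5 + H] sends this range to eigenvectors for 5. *)
Lemma eigenvalue5 : aligned != 0 -> eigenvalue H 5.
Proof.
have [a1 a2 a3 a4] := aligned_mul; move=> al0.
have aY : aligned *m Y = 4 *: aligned.
  rewrite /Y !mulmxDr a1 a2 a3 a4; move: aligned => K.
  by apply/matrixP => i j; rewrite !mxE; ring.
have aHH : aligned *m (H *m H) = 25 *: aligned.
  rewrite hamiltonian_sqr interaction_sqr ABP mulmxDr -scalemxAr.
  have -> : aligned *m (Y *m Y) = 16 *: aligned.
    by rewrite mulmxA aY -scalemxAl aY scalerA -natrM.
  rewrite mulmxDr mul_mx_scalar mulr2n mulmxDr !mulmxA a1 a2 a3 a4.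
  by move: aligned => K; apply/matrixP => i j; rewrite !mxE; field.
have eig : aligned *m (5%:M + H) *m H = 5 *: (aligned *m (5%:M + H)).
  move: aligned H aHH => K L KLL; rewrite -mulmxA mulmxDl mul_scalar_mx.
  rewrite [LHS]mulmxDr KLL -scalemxAr [in RHS]mulmxDr mul_mx_scalar scalerDr.
  by rewrite scalerA -natrM addrC.
(* Nonvanishing: [A + B] anticommutes with [P1], so right multiplication by [1 + P1] kills the term
   with [A + B] and leaves 18 times [aligned]. *)
have nz : aligned *m (5%:M + H) != 0.
  apply: contra_neq al0 => a0.
  have := congr1 (mulmx^~ (1%:M + P1)) a0; rewrite mul0mx.
  have -> : aligned *m (5%:M + H) =
      9 *: aligned + (3 / 2) *: (aligned *m (A + B)).
    rewrite /H; move: aligned (A + B) Y aY => K X Z KZ.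
    rewrite !mulmxDr -scalemxAr KZ mul_mx_scalar; move: (K *m X) => KX.
    by apply/matrixP => i j; rewrite !mxE; ring.
  rewrite mulmxDl -!scalemxAl -mulmxA.
  have -> : (A + B) *m (1%:M + P1) = (1%:M - P1) *m (A + B).
    rewrite !(mulmxDl, mulmxDr) AP1 BP1 !mulNmx !mul1mx !mulmx1.
    move: (P1 *m A) (P1 *m B) => PA PB.
    by apply/matrixP => i j; rewrite !mxE; ring.
  rewrite mulmxA [aligned *m (1%:M - P1)]mulmxBr a1 mulmx1 subrr mul0mx scaler0.
  rewrite addr0 mulmxDr a1 mulmx1 scalerDr -scalerDl -natrD.
  by move/eqP; rewrite scaler_eq0 pnatr_eq0 => /eqP.
have [j nj] : exists j, row j (aligned *m (5%:M + H)) != 0.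
  apply/existsP; rewrite -negb_forall; apply: contra nz => /forallP r0.
  by apply/eqP/row_matrixP => j; rewrite row0; apply/eqP.
apply/eigenvalueP; exists (row j (aligned *m (5%:M + H))) => //.
by rewrite -row_mul eig linearZ.
Qed.

End AnticommutingSplit.

(** The hypothesis says [P *m X = - X]; conjugating by [c] flips [P] but fixes [X], giving also
    [P *m X = X]. This serves to strip the factors of [aligned] one at a time. *)
Lemma flip_cancel (R : realType) d (c P X : 'M[R[i]]_d) :
  c *m c = 1%:M -> c *m P = - (P *m c) -> c *m X = X *m c ->
  (1%:M + P) *m X = 0 -> X = 0.
Proof.
move=> cc cP cX PX.
have PX' : P *m X = - X.
  by apply/eqP; rewrite -addr_eq0 addrC -[X in X + _]mul1mx -mulmxDl PX.
have : c *m (P *m X) *m c = X.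
  rewrite mulmxA cP !mulNmx -[P *m c *m X]mulmxA cX mulmxA PX' !mulNmx opprK.
  by rewrite -mulmxA cc mulmx1.
rewrite PX' mulmxN mulNmx cX -mulmxA cc mulmx1 => /eqP.
rewrite -subr_eq0 -opprD oppr_eq0 -mulr2n -scaler_nat scaler_eq0 pnatr_eq0 /=.
by move/eqP.
Qed.

(** * The Hamiltonian terms in Majorana operators *)

Section ModeOperators.

Variables (R : realType) (n : nat) (a : 'I_n -> 'M[R[i]]_(2 ^ n)).
Hypothesis ha : annihilation_operators a.

Local Notation x k := (majorana a (fst_idx k)).
Local Notation y k := (majorana a (snd_idx k)).

Lemma fst_majoranaE k : x k = a k + adjoint (a k).
Proof.
rewrite /majorana; have -> : odd (fst_idx k) = false by rewrite /=; lia.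
by have -> : mode (fst_idx k) = k by apply/val_inj => /=; lia.
Qed.

Lemma snd_majoranaE k : y k = 'i *: (a k - adjoint (a k)).
Proof.
rewrite /majorana; have -> : odd (snd_idx k) by rewrite /=; lia.
by have -> : mode (snd_idx k) = k by apply/val_inj => /=; lia.
Qed.

Lemma annihilationE k : a k = 2^-1 *: (x k - 'i *: y k).
Proof.
rewrite fst_majoranaE snd_majoranaE scalerA -expr2 sqrCi scaleN1r opprK.
by apply/matrixP => p q; rewrite !mxE; field.
Qed.

Lemma creationE k : adjoint (a k) = 2^-1 *: (x k + 'i *: y k).
Proof.
rewrite fst_majoranaE snd_majoranaE scalerA -expr2 sqrCi scaleN1r.
by apply/matrixP => p q; rewrite !mxE; field.
Qed.

Lemma number_opE k : number_op a k = 2^-1 *: (1%:M - 'i *: (x k *m y k)).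
Proof.
have cc := majorana_clifford ha.
have yx : y k *m x k = - (x k *m y k).
  by apply: (clifford_swap cc); rewrite -val_eqE /=; lia.
have := sqrCi R[i]; rewrite expr2 => ii.
rewrite /number_op {1}creationE {1}annihilationE -scalemxAl -scalemxAr.
rewrite !(mulmxDl, mulmxDr, mulmxN, mulNmx) -!scalemxAl -!scalemxAr yx.
rewrite !(clifford_sqr cc).
move: (x k *m y k) => J; apply/matrixP => p q; rewrite !mxE.
by case: (p == q) => /=; field: ii.
Qed.

Lemma hoppingE j k : j != k ->
  - (adjoint (a j) *m a k) - adjoint (a k) *m a j =
  2^-1 *: ('i *: (x j *m y k) - 'i *: (y j *m x k)).
Proof.
move=> jk; have cc := majorana_clifford ha.
have ne (u v : 'I_(2 * n)) : mode u = j -> mode v = k -> u != v.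
  by move=> uj vk; apply: contraNneq jk => uv; rewrite -uj -vk uv.
have mf (l : 'I_n) : mode (fst_idx l) = l by apply/val_inj => /=; lia.
have ms (l : 'I_n) : mode (snd_idx l) = l by apply/val_inj => /=; lia.
have sw u v : mode u = j -> mode v = k ->
    majorana a v *m majorana a u = - (majorana a u *m majorana a v).
  by move=> uj vk; apply: (clifford_swap cc); rewrite eq_sym ne.
rewrite !creationE (annihilationE k) (annihilationE j) -!scalemxAl -!scalemxAr.
rewrite !(mulmxDl, mulmxDr, mulmxN, mulNmx) -!scalemxAl -!scalemxAr.
rewrite !(sw (fst_idx j) (fst_idx k), sw (fst_idx j) (snd_idx k),
  sw (snd_idx j) (fst_idx k), sw (snd_idx j) (snd_idx k)) //.
have iZ (T : 'M[R[i]]_(2 ^ n)) : 'i *: ('i *: T) = - T.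
  by rewrite scalerA -expr2 sqrCi scaleN1r.
rewrite !(scalerN, iZ); move: (x j *m x k) ('i *: (x j *m y k))
  ('i *: (y j *m x k)) (y j *m y k); move: (2 ^ n)%N => N T1 T2 T3 T4.
by apply/matrixP => p q; rewrite !mxE; field.
Qed.

(** Each number operator is one half minus half of a quadratic Majorana term. The potential 3, half
    of the interaction strength 6, cancels exactly the quadratic terms and leaves the quartic
    one. *)
Lemma interactionE j k :
  6 *: ((4^-1)%:M - number_op a j *m number_op a k)
  + (3 *: (number_op a j - (2^-1)%:M) + 3 *: (number_op a k - (2^-1)%:M)) =
  (3 / 2) *: (x j *m y j *m x k *m y k).
Proof.
rewrite !number_opE -[x j *m y j *m x k *m y k]mulmxA.
move: (x j *m y j) (x k *m y k) => J K.
rewrite -scalemxAl -scalemxAr !(mulmxDl, mulmxDr, mulmxN, mulNmx).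
have iZ (T : 'M[R[i]]_(2 ^ n)) : 'i *: ('i *: T) = - T.
  by rewrite scalerA -expr2 sqrCi scaleN1r.
rewrite !mulmx1 !mul1mx -!scalemxAl -!scalemxAr !(scalerN, iZ).
move: (J *m K) ('i *: J) ('i *: K); move: (2 ^ n)%N => N JK iJ iK.
apply/matrixP => p q; rewrite !mxE.
by case: (p == q) => /=; field.
Qed.

End ModeOperators.

(** The hypotheses are the norms of eight covariance rows, restricted to one quartic block and one
    hopping entry; each variable occurs in exactly two rows. Their sum bounds the squares of all
    block entries by 4 minus those of [p], [q], [r], [s]. *)
Lemma gaussian_bound (R : realType)
    (a12 a13 a14 a23 a24 a34 b12 b13 b14 b23 b24 b34 p q r s : R) :
  p ^+ 2 + a12 ^+ 2 + a13 ^+ 2 + a14 ^+ 2 <= 1 ->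
  q ^+ 2 + a12 ^+ 2 + a23 ^+ 2 + a24 ^+ 2 <= 1 ->
  r ^+ 2 + a13 ^+ 2 + a23 ^+ 2 + a34 ^+ 2 <= 1 ->
  s ^+ 2 + a14 ^+ 2 + a24 ^+ 2 + a34 ^+ 2 <= 1 ->
  q ^+ 2 + b12 ^+ 2 + b13 ^+ 2 + b14 ^+ 2 <= 1 ->
  p ^+ 2 + b12 ^+ 2 + b23 ^+ 2 + b24 ^+ 2 <= 1 ->
  s ^+ 2 + b13 ^+ 2 + b23 ^+ 2 + b34 ^+ 2 <= 1 ->
  r ^+ 2 + b14 ^+ 2 + b24 ^+ 2 + b34 ^+ 2 <= 1 ->
  3 / 2 * - (a12 * a34 - a13 * a24 + a14 * a23)
  + 3 / 2 * - (b12 * b34 - b13 * b24 + b14 * b23) + (p - q + r - s) <= 13 / 3.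
Proof.
have pf (u v w u' v' w' : R) : - (u * u' - v * v' + w * w') <=
    (u ^+ 2 + u' ^+ 2 + v ^+ 2 + v' ^+ 2 + w ^+ 2 + w' ^+ 2) / 2.
  have := sqr_ge0 (u + u'); have := sqr_ge0 (v - v'); have := sqr_ge0 (w + w').
  by rewrite !expr2; lra.
have := pf a12 a13 a14 a34 a24 a23; have := pf b12 b13 b14 b34 b24 b23.
(* The function 3/4 (1 - p^2) + p has its maximum 13/12 at 2/3; [q] and [s] enter the energy with a
   minus sign, hence the opposite shift. *)
have := sqr_ge0 (p - 2 / 3); have := sqr_ge0 (q + 2 / 3).
have := sqr_ge0 (r - 2 / 3); have := sqr_ge0 (s + 2 / 3).
by rewrite !expr2; lra.
Qed.

(** * The Hubbard dimer: spectrum and Gaussian energy *)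

Notation site0 := (@Ordinal 4 0 isT).
Notation site1 := (@Ordinal 4 1 isT).
Notation site2 := (@Ordinal 4 2 isT).
Notation site3 := (@Ordinal 4 3 isT).

Section HubbardDimer.

Variables (R : realType) (d : nat) (c : 'I_(2 * 4) -> 'M[R[i]]_d).
Hypotheses (cc : clifford c) (hc : forall j, adjoint (c j) = c j).

Local Notation x k := (fst_idx k).
Local Notation y k := (snd_idx k).

(** Keeping coefficient and word apart reduces commutation, squares and self-adjointness to running
    [sort_word] on concrete lists. *)
Definition scaled_word (p : R[i] * seq 'I_(2 * 4)) : 'M[R[i]]_d :=
  p.1 *: word c p.2.

Lemma scaled_wordM p q :
  scaled_word p *m scaled_word q = scaled_word (p.1 * q.1, p.2 ++ q.2).
Proof. by rewrite /scaled_word -scalemxAl -scalemxAr scalerA word_cat. Qed.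

Lemma scaled_word_swap b p q :
  (sort_word (p.2 ++ q.2)).2 == (sort_word (q.2 ++ p.2)).2 ->
  (sort_word (p.2 ++ q.2)).1 (+) (sort_word (q.2 ++ p.2)).1 = b ->
  scaled_word p *m scaled_word q =
  (-1) ^+ b *: (scaled_word q *m scaled_word p).
Proof.
move=> e1 e2; rewrite !scaled_wordM /scaled_word /=.
by rewrite (word_eq_sign cc e1 e2) !scalerA; congr (_ *: _); ring.
Qed.

Lemma scaled_word_commute p q :
  (sort_word (p.2 ++ q.2)).2 == (sort_word (q.2 ++ p.2)).2 ->
  (sort_word (p.2 ++ q.2)).1 (+) (sort_word (q.2 ++ p.2)).1 = false ->
  scaled_word p *m scaled_word q = scaled_word q *m scaled_word p.
Proof. by move=> e1 e2; rewrite (scaled_word_swap e1 e2) scale1r. Qed.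

Lemma scaled_word_anticommute p q :
  (sort_word (p.2 ++ q.2)).2 == (sort_word (q.2 ++ p.2)).2 ->
  (sort_word (p.2 ++ q.2)).1 (+) (sort_word (q.2 ++ p.2)).1 = true ->
  scaled_word p *m scaled_word q = - (scaled_word q *m scaled_word p).
Proof. by move=> e1 e2; rewrite (scaled_word_swap e1 e2) scaleN1r. Qed.

Lemma scaled_word_sqr b p :
  (sort_word (p.2 ++ p.2)).2 == [::] -> (sort_word (p.2 ++ p.2)).1 = b ->
  p.1 * p.1 * (-1) ^+ b = 1 -> scaled_word p *m scaled_word p = 1%:M.
Proof.
move=> /eqP e1 e2 pp; rewrite scaled_wordM /scaled_word /=.
by rewrite (sort_wordE cc) e1 e2 !scalerA pp scale1r.
Qed.

Lemma adjoint_scaled_word b p :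
  (sort_word (rev p.2)).2 == (sort_word p.2).2 ->
  (sort_word (rev p.2)).1 (+) (sort_word p.2).1 = b ->
  Num.conj p.1 * (-1) ^+ b = p.1 -> adjoint (scaled_word p) = scaled_word p.
Proof.
move=> e1 e2 pp; rewrite /scaled_word adjointZ adjoint_word //.
by rewrite (word_eq_sign cc e1 e2) scalerA pp.
Qed.

(** The digits count modes from 1, so 1 and 3 stand for [site0] and [site2]. *)
Definition quartic13 := (1 : R[i], [:: x site0; y site0; x site2; y site2]).
Definition quartic24 := (1 : R[i], [:: x site1; y site1; x site3; y site3]).
Definition hop1 := ('i%R : R[i], [:: x site0; y site1]).
Definition hop2 := ((- 'i)%R : R[i], [:: y site0; x site1]).
Definition hop3 := ('i%R : R[i], [:: x site2; y site3]).
Definition hop4 := ((- 'i)%R : R[i], [:: y site2; x site3]).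

Local Notation W := scaled_word.

Definition hubbard : 'M[R[i]]_d :=
  (3 / 2) *: (W quartic13 + W quartic24) + (W hop1 + W hop2 + W hop3 + W hop4).

Lemma hubbardE : hubbard = (3 / 2) *:
    (c (x site0) *m c (y site0) *m c (x site2) *m c (y site2)
     + c (x site1) *m c (y site1) *m c (x site3) *m c (y site3))
  + ('i *: (c (x site0) *m c (y site1)) - 'i *: (c (y site0) *m c (x site1))
     + 'i *: (c (x site2) *m c (y site3)) - 'i *: (c (y site2) *m c (x site3))).
Proof.
rewrite /hubbard /scaled_word /= !mulmx1 !scale1r !scaleNr !mulmxA.
by congr (_ *: (_ + _) + (_ - _ + _ - _)).
Qed.

Let ii : 'i * 'i = -1 :> R[i]. Proof. by rewrite -expr2 sqrCi. Qed.

Lemma quartic_sqr : W quartic13 *m W quartic13 = 1%:M /\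
  W quartic24 *m W quartic24 = 1%:M.
Proof.
by split; apply: (@scaled_word_sqr false) => //=; rewrite !mulr1.
Qed.

Lemma hop_sqr : [/\ W hop1 *m W hop1 = 1%:M, W hop2 *m W hop2 = 1%:M,
  W hop3 *m W hop3 = 1%:M & W hop4 *m W hop4 = 1%:M].
Proof.
by split; apply: (@scaled_word_sqr true) => //=; rewrite expr1 ?mulrNN ii mulrNN mulr1.
Qed.

Lemma hop_commute : [/\ W hop1 *m W hop2 = W hop2 *m W hop1,
  W hop1 *m W hop3 = W hop3 *m W hop1 & W hop1 *m W hop4 = W hop4 *m W hop1] /\
  [/\ W hop2 *m W hop3 = W hop3 *m W hop2, W hop2 *m W hop4 = W hop4 *m W hop2
  & W hop3 *m W hop4 = W hop4 *m W hop3].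
Proof. by split; split; apply: scaled_word_commute. Qed.

Lemma quartic_hop_anticommute :
  [/\ W quartic13 *m W hop1 = - (W hop1 *m W quartic13),
      W quartic13 *m W hop2 = - (W hop2 *m W quartic13),
      W quartic13 *m W hop3 = - (W hop3 *m W quartic13)
    & W quartic13 *m W hop4 = - (W hop4 *m W quartic13)] /\
  [/\ W quartic24 *m W hop1 = - (W hop1 *m W quartic24),
      W quartic24 *m W hop2 = - (W hop2 *m W quartic24),
      W quartic24 *m W hop3 = - (W hop3 *m W quartic24)
    & W quartic24 *m W hop4 = - (W hop4 *m W quartic24)].
Proof. by split; split; apply: scaled_word_anticommute. Qed.

(** Both sides use each of the eight generators once, with orderings of equal parity, and the
    hopping coefficients multiply to 1. *)
Lemma quartic_product :
  W quartic13 *m W quartic24 = W hop1 *m W hop2 *m W hop3 *m W hop4.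
Proof.
have sw := @word_eq_sign _ _ _ _ cc false (quartic13.2 ++ quartic24.2)
  (hop1.2 ++ hop2.2 ++ hop3.2 ++ hop4.2) isT erefl.
rewrite !scaled_wordM -!catA; move: sw.
rewrite /scaled_word [_.2]/= => ->; rewrite [in RHS]/= expr0 !scalerA.
congr (_ *: _); rewrite /= !(mulNr, mulrN); ring: ii.
Qed.

Lemma adjoint_quartic :
  adjoint (W quartic13) = W quartic13 /\ adjoint (W quartic24) = W quartic24.
Proof.
by split; apply: (@adjoint_scaled_word false) => //=; rewrite rmorph1 mulr1.
Qed.

Lemma adjoint_hop :
  [/\ adjoint (W hop1) = W hop1, adjoint (W hop2) = W hop2,
      adjoint (W hop3) = W hop3 & adjoint (W hop4) = W hop4].
Proof.
by split; apply: (@adjoint_scaled_word true) => //=;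
  rewrite ?rmorphN /= conjCi expr1 mulrN1 ?opprK.
Qed.

Lemma hubbard_eigenvalue_le5 z : eigenvalue hubbard z -> z <= 5.
Proof.
have [AA BB] := quartic_sqr; have [P11 P22 P33 P44] := hop_sqr.
have [[P12 P13 P14] [P23 P24 P34]] := hop_commute.
have [[AP1 AP2 AP3 AP4] [BP1 BP2 BP3 BP4]] := quartic_hop_anticommute.
have [hA hB] := adjoint_quartic; have [hP1 hP2 hP3 hP4] := adjoint_hop.
have AB : W quartic13 *m W quartic24 = W quartic24 *m W quartic13.
  exact: scaled_word_commute.
move=> hz; exact (eigenvalue_le5 AA BB AB P11 P22 P33 P44 P12 P13 P14 P23 P24 P34
  AP1 AP2 AP3 AP4 BP1 BP2 BP3 BP4 hA hB hP1 hP2 hP3 hP4 hz).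
Qed.

Let letterE j : c j = W (1, [:: j]).
Proof. by rewrite /scaled_word /= mulmx1 scale1r. Qed.

(** The first letter of each hopping word flips that word and commutes with the later ones: the
    triangular pattern needed to apply [flip_cancel] repeatedly. *)
Lemma letter_hop :
  [/\ c (x site0) *m W hop1 = - (W hop1 *m c (x site0)),
      c (y site0) *m W hop2 = - (W hop2 *m c (y site0)),
      c (x site2) *m W hop3 = - (W hop3 *m c (x site2))
    & c (y site2) *m W hop4 = - (W hop4 *m c (y site2))] /\
  [/\ [/\ c (x site0) *m W hop2 = W hop2 *m c (x site0),
          c (x site0) *m W hop3 = W hop3 *m c (x site0)
        & c (x site0) *m W hop4 = W hop4 *m c (x site0)],
      c (y site0) *m W hop3 = W hop3 *m c (y site0),
      c (y site0) *m W hop4 = W hop4 *m c (y site0)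
    & c (x site2) *m W hop4 = W hop4 *m c (x site2)].
Proof.
rewrite !letterE; split; first by split; apply: scaled_word_anticommute.
by split; [split| | |]; apply: scaled_word_commute.
Qed.

(** If the product vanished, [flip_cancel] would remove its factors from the left one by one until
    only [1 = 0] remained. *)
Lemma aligned_neq0 : 1%:M != 0 :> 'M[R[i]]_d ->
  (1%:M + W hop1) *m (1%:M + W hop2) *m (1%:M + W hop3) *m (1%:M + W hop4) != 0.
Proof.
have [[c1 c2 c3 c4] [[c12 c13 c14] c23 c24 c34]] := letter_hop.
move: (W hop1) (W hop2) (W hop3) (W hop4) c1 c2 c3 c4 c12 c13 c14 c23 c24 c34.
move=> P1 P2 P3 P4 c1 c2 c3 c4 c12 c13 c14 c23 c24 c34; apply: contra_neq.
have cD e (X : 'M[R[i]]_d) : e *m X = X *m e -> e *m (1%:M + X) = (1%:M + X) *m e.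
  by move=> eX; rewrite mulmxDl mulmxDr eX mulmx1 mul1mx.
have cM e (X Z : 'M[R[i]]_d) : e *m X = X *m e -> e *m Z = Z *m e ->
    e *m (X *m Z) = X *m Z *m e.
  by move=> eX eZ; rewrite mulmxA eX -!mulmxA eZ.
rewrite -!mulmxA => /(flip_cancel (clifford_sqr cc _) c1) z1.
have /(flip_cancel (clifford_sqr cc _) c2) z2 := z1 (cM _ _ _ (cD _ _ c12)
  (cM _ _ _ (cD _ _ c13) (cD _ _ c14))).
have /(flip_cancel (clifford_sqr cc _) c3) z3 := z2 (cM _ _ _ (cD _ _ c23) (cD _ _ c24)).
have := z3 (cD _ _ c34); rewrite -[1%:M + P4]mulmx1.
by move/(flip_cancel (clifford_sqr cc _) c4); apply; rewrite mulmx1 mul1mx.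
Qed.

Lemma hubbard_eigenvalue5 : 1%:M != 0 :> 'M[R[i]]_d -> eigenvalue hubbard 5.
Proof.
move=> /aligned_neq0 nz.
have [AA BB] := quartic_sqr; have [P11 P22 P33 P44] := hop_sqr.
have [[P12 P13 P14] [P23 P24 P34]] := hop_commute.
have [[AP1 AP2 AP3 AP4] [BP1 BP2 BP3 BP4]] := quartic_hop_anticommute.
have AB : W quartic13 *m W quartic24 = W quartic24 *m W quartic13.
  exact: scaled_word_commute.
exact (eigenvalue5 AA BB AB P11 P22 P33 P44 P12 P13 P14 P23 P24 P34
  AP1 AP2 AP3 AP4 BP1 BP2 BP3 BP4 quartic_product nz).
Qed.

Variables (rho : 'M[R[i]]_d) (M : 'I_(2 * 4) -> 'I_(2 * 4) -> R).
Hypothesis rhoM : forall j, c j *m rho - rho *m c j =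
  'i *: \sum_k (M j k)%:C *: (c k *m rho + rho *m c k).
Hypothesis hrho : density_matrix rho.

Let rho1 : \tr rho = 1. Proof. by case: hrho. Qed.

Lemma trace_hop z u v : u != v ->
  \tr (rho *m W (z, [:: u; v])) = z * (- 'i * (M u v)%:C).
Proof.
by move=> uv; rewrite /scaled_word /= mulmx1 -scalemxAr mxtraceZ (wick2 cc rhoM).
Qed.

Lemma trace_quartic u v s t : uniq [:: u; v; s; t] ->
  \tr (rho *m W (1, [:: u; v; s; t])) =
    (- (M u v * M s t - M u s * M v t + M u t * M v s))%:C.
Proof.
move=> ud; rewrite /scaled_word /= mulmx1 scale1r (mulmxA (c v)) (wick4 cc rhoM) //.
by rewrite rmorphN.
Qed.

Lemma hubbard_energy : \tr (rho *m hubbard) = (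
  3 / 2 * - (M (x site0) (y site0) * M (x site2) (y site2)
    - M (x site0) (x site2) * M (y site0) (y site2)
    + M (x site0) (y site2) * M (y site0) (x site2))
  + 3 / 2 * - (M (x site1) (y site1) * M (x site3) (y site3)
    - M (x site1) (x site3) * M (y site1) (y site3)
    + M (x site1) (y site3) * M (y site1) (x site3))
  + (M (x site0) (y site1) - M (y site0) (x site1)
    + M (x site2) (y site3) - M (y site2) (x site3)))%:C.
Proof.
have trH (A B P1 P2 P3 P4 : 'M[R[i]]_d) :
    \tr (rho *m ((3 / 2) *: (A + B) + (P1 + P2 + P3 + P4))) =
    3 / 2 * (\tr (rho *m A) + \tr (rho *m B)) + (\tr (rho *m P1)
      + \tr (rho *m P2) + \tr (rho *m P3) + \tr (rho *m P4)).
  by rewrite !mulmxDr -scalemxAr !mulmxDr !mxtraceD mxtraceZ !mxtraceD.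
have realE (z q1 q2 h1 h2 h3 h4 : R) : z%:C * (q1%:C + q2%:C)
    + ('i * (- 'i * h1%:C) + (- 'i) * (- 'i * h2%:C)
      + 'i * (- 'i * h3%:C) + (- 'i) * (- 'i * h4%:C)) =
    (z * q1 + z * q2 + (h1 - h2 + h3 - h4))%:C.
  by rewrite !(rmorphD, rmorphN, rmorphM) /=; ring: ii.
have z32 : 3 / 2 = (3 / 2)%:C :> R[i] by rewrite rmorphM fmorphV !rmorph_nat.
rewrite /hubbard trH -realE {1}z32; congr (_ * (_ + _) + (_ + _ + _ + _)).
- exact: trace_quartic.
- exact: trace_quartic.
- exact: trace_hop.
- exact: trace_hop.
- exact: trace_hop.
- exact: trace_hop.
Qed.

Lemma hubbard_energy_le : \tr (rho *m hubbard) <= (13 / 3)%:C.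
Proof.
rewrite hubbard_energy lecR.
have anti := covariance_antisym cc rhoM hrho.
have row j k1 k2 k3 k4 : uniq [:: j; k1; k2; k3; k4] ->
    M j k1 ^+ 2 + M j k2 ^+ 2 + M j k3 ^+ 2 + M j k4 ^+ 2 <= 1.
  rewrite [uniq _]/= => /andP[jk uk].
  have := covariance_row_le1 cc rhoM hrho hc (s := [:: k1; k2; k3; k4]) uk jk.
  by rewrite !big_cons big_nil addr0 !addrA.
have sqN (j k : 'I_(2 * 4)) : j != k -> M k j ^+ 2 = M j k ^+ 2.
  by move=> jk; rewrite anti // sqrrN.
(* The rows come in the order of the two quartic words. Entries below the diagonal are transposed by
   antisymmetry, which does not change their squares. *)
apply: gaussian_bound.
- exact: row.
- by rewrite -(sqN (x site0) (y site0)) //; apply: row.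
- by rewrite -(sqN (x site0) (x site2)) //
    -(sqN (y site0) (x site2)) //; apply: row.
- by rewrite -(sqN (x site0) (y site2)) //
    -(sqN (y site0) (y site2)) //
    -(sqN (x site2) (y site2)) //; apply: row.
- by rewrite -(sqN (y site0) (x site1)) //; apply: row.
- by rewrite -(sqN (x site0) (y site1)) //
    -(sqN (x site1) (y site1)) //; apply: row.
- by rewrite -(sqN (y site2) (x site3)) //
    -(sqN (x site1) (x site3)) //
    -(sqN (y site1) (x site3)) //; apply: row.
- by rewrite -(sqN (x site2) (y site3)) //
    -(sqN (x site1) (y site3)) //
    -(sqN (y site1) (y site3)) //
    -(sqN (x site3) (y site3)) //; apply: row.
Qed.

End HubbardDimer.

(** * Identification of the Hamiltonian and conclusion *)

Lemma sum_sites (V : nmodType) (F : 'I_4 -> V) :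
  \sum_(j < 4) F j = F site0 + F site1 + F site2 + F site3.
Proof.
rewrite !big_ord_recl big_ord0 addr0 !addrA.
by congr (F _ + F _ + F _ + F _); apply: val_inj.
Qed.

Lemma hamiltonian_hubbard (R : realType) (a : 'I_4 -> 'M[R[i]]_(2 ^ 4)) :
  annihilation_operators a ->
  hamiltonian a [set (site0, site2); (site1, site3)]
    [set (site0, site1); (site2, site3)] (fun=> 6) (fun=> 2) (fun=> 3) =
  hubbard (majorana a).
Proof.
move=> ha; rewrite /hamiltonian !big_setU1 ?inE //= !big_set1 sum_sites.
rewrite !rmorph_nat /=.
have i02 := interactionE ha site0 site2; have i13 := interactionE ha site1 site3.
have h01 := hoppingE ha (j := site0) (k := site1) isT.
have h23 := hoppingE ha (j := site2) (k := site3) isT.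
(* Every site lies on exactly one interaction edge, so the four potential terms are shared out
   between the two edges; the hopping weight 2 cancels the factor one half of [hoppingE]. *)
have regroup (V : lmodType R[i]) (I02 I13 n0 n1 n2 n3 h1 h2 A B P1 P2 P3 P4 : V) :
    I02 + (n0 + n2) = (3 / 2) *: A -> I13 + (n1 + n3) = (3 / 2) *: B ->
    h1 = 2^-1 *: (P1 - P2) -> h2 = 2^-1 *: (P3 - P4) ->
    I02 + I13 + (n0 + n1 + n2 + n3) + (2 *: h1 + 2 *: h2) =
    (3 / 2) *: (A + B) + (P1 - P2 + P3 - P4).
  move=> eA eB -> ->; rewrite !scalerA divff ?pnatr_eq0 // !scale1r.
  rewrite scalerDr -eA -eB; congr (_ + _); last by rewrite addrA.
  rewrite [RHS]addrACA -!addrA; congr (_ + (_ + (_ + _))); exact: addrCA.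
rewrite (regroup _ _ _ _ _ _ _ _ _ _ _ _ _ _ _ i02 i13 h01 h23).
by rewrite hubbardE.
Qed.

Theorem propositionB1 (R : realType) (a : 'I_4 -> 'M[R[i]]_(2 ^ 4))
    (vac : 'cV[R[i]]_(2 ^ 4))
    (ha : annihilation_operators a) (hvac : vacuum a vac) :
  exists (E E' : {set 'I_4 * 'I_4}) (w w' : 'I_4 * 'I_4 -> R) (mu : 'I_4 -> R),
    [/\ edge_set E, edge_set E', forall e, e \in E -> 0 <= w e
      & exists lam : R,
          [/\ largest_eigenvalue (hamiltonian a E E' w w' mu) lam,
              0 < lam
            & forall rho : 'M[R[i]]_(2 ^ 4), gaussian_state a rho ->
                \tr (rho *m hamiltonian a E E' w w' mu) / lam%:C
                  <= (1 - 96 / 10 ^+ 5)%:C]].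
Proof.
(* Interaction edges join the two spins on one site; hopping edges join the two sites for one
   spin. *)
exists [set (site0, site2); (site1, site3)], [set (site0, site1); (site2, site3)].
exists (fun=> 6), (fun=> 2), (fun=> 3).
have cc := majorana_clifford ha; have hc := adjoint_majorana a.
split=> [e|e|_ _|]; rewrite ?inE; try by case/orP => /eqP ->.
  by rewrite ler0n.
have five : (5 : R)%:C = 5 by rewrite rmorph_nat.
exists 5; rewrite hamiltonian_hubbard //; split; [split|by rewrite ltr0n|].
- rewrite five; apply: hubbard_eigenvalue5 => //.
  by apply/eqP => /matrixP/(_ ord0 ord0)/eqP; rewrite !mxE eqxx oner_eq0.
- by move=> z; rewrite five; apply: hubbard_eigenvalue_le5.
move=> rho [hrho [lam [Q [_ [QQ _] rhoE]]]].
have [M rhoM] := gaussian_commutator ha QQ lam.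
have := hubbard_energy_le cc hc (rhoM _ _ rhoE) hrho.
(* It remains to compare 13/3 with 5 times 0.99904. *)
rewrite ler_pdivrMr; last by rewrite (ltcR 0) ltr0n.
move=> le13; apply: (le_trans le13); rewrite -rmorphM lecR.
have -> : (10 : R) ^+ 5 = 100 * (100 * 10) by ring.
by lra.
Qed.
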